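(* The reduction mapping an arithmetic circuit $C$ to the compiled $\mathrm{ARM}(3)$ instance $\mathcal{I}(C)$ described in the context produces rational constraint data (the matrices $A_\ell$ and scalars $b_\ell$) of total bit-length polynomial in the bit-length of the input circuit $C$.
   Context: Notation: $[m]=\{1,\dots,m\}$; $X[I,J]$ is the submatrix of $X$ with rows in $I$ and columns in $J$. $\mathrm{ARM}(3)$: given rational affine constraints $\langle A_\ell,X\rangle=b_\ell$ on $X\in\mathbb{R}^{m\times n}$ (with $\langle A,X\rangle=\sum_{i,j}A_{ij}X_{ij}$), decide whether some $X$ satisfies them with $\operatorname{rank}(X)\le 3$. Arithmetic circuit: a finite directed acyclic graph with input gates (labelled by real variables), constant gates (labelled by $c\in\mathbb{Q}$), fan-in-2 gates $+$ and $\times$, fan-in-1 negation gates, and a designated output gate $g_{\mathrm{out}}$. Its bit-length counts the number of gates plus the total bit-length of all rational constants (numerators and denominators in reduced form). Compiled instance $\mathcal{I}(C)$. There is one matrix variable $X\in\mathbb{R}^{m\times n}$, with the following affine constraints. (a) Gauge: for fixed $I_0\subseteq[m]$, $J_0\subseteq[n]$ of size 3 and a fixed rational $B\in\mathbb{R}^{3\times 3}$ with $\det B\ne 0$ (e.g. $B=I_3$), $X[I_0,J_0]=B$. (b) Carriers: every occurrence of a circuit value (a gate's output, and each use of a value as an input of a gate) is given its own designated carrier position $(r,c)$; the value of the occurrence is decoded as $X_{r,c}$. For occurrences representing the same circuit value, equality is enforced by copy constraints $X_{r,c}=X_{r',c'}$ (one linking each use to the producing gate's output carrier). (c) Gadgets: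 for each gate, a gadget acting on the carriers of its own inputs and output. Constant gate $z=c$: $X_{r_z,c_z}=c$. Addition $z=x+y$: $X_{r_z,c_z}-X_{r_x,c_x}-X_{r_y,c_y}=0$. Negation $z=-x$: $X_{r_z,c_z}+X_{r_x,c_x}=0$. Multiplication $z=xy$: for row indices $r_1\neq r_2$ and column indices $c_1\ne c_2$ of the gadget, $X[\{r_1,r_2\},\{c_1,c_2\}]=\begin{pmatrix}1&x\\ y&z\end{pmatrix}$, i.e. $X_{r_1,c_1}=1$ and $X_{r_1,c_2},X_{r_2,c_1},X_{r_2,c_2}$ carry $x,y,z$ respectively; other entries are unconstrained by the gadget. (d) Output: $X_{r_{\mathrm{out}},c_{\mathrm{out}}}=0$ for the carrier of $g_{\mathrm{out}}$. Apart from $I_0$ and $J_0$, distinct gadgets use disjoint sets of (fresh) row indices and disjoint sets of (fresh) column indices, $O(1)$ of each per gadget; $m$ and $n$ are the total numbers of row and column indices used. *)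

(* Defs.v *)
From HB Require Import structures.
From mathcomp Require Import all_boot all_order all_algebra reals.

Set Implicit Arguments.
Unset Strict Implicit.
Unset Printing Implicit Defensive.

Import Order.TTheory GRing.Theory Num.Theory.

Local Open Scope ring_scope.

(* [trunc_log 2 0 = 0], so 0 has bit-length 1 and, in a dense encoding, every
   entry (zero or not) contributes. *)
Definition nat_bits (k : nat) : nat := (trunc_log 2 k).+1.

(* One extra bit for the sign. *)
Definition int_bits (z : int) : nat := (nat_bits `|z|%N).+1.

(* [numq]/[denq] is the reduced form. *)
Definition rat_bits (q : rat) : nat := (int_bits (numq q) + int_bits (denq q))%N.

(* Real variables are named by natural numbers. *)
Inductive gate (V : Type) : Type :=
  | Input of nat
  | Const of rat
  | Add of V & V
  | Mul of V & V
  | Neg of V.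

Arguments Input {V} _.
Arguments Const {V} _.

Inductive slot : Type := Lhs | Rhs | Out.

(* The single operand of a negation is its [Lhs]. *)
Definition operand (V : Type) (g : gate V) (s : slot) : option V :=
  match s, g with
  | Lhs, (Add x _ | Mul x _ | Neg x) => Some x
  | Rhs, (Add _ y | Mul _ y) => Some y
  | _, _ => None
  end.

Definition feeds (V : eqType) (g : gate V) (w : V) : bool :=
  (operand g Lhs == Some w) || (operand g Rhs == Some w).

Record circuit : Type := Circuit {
  vertex : finType;
  gate_of : vertex -> gate vertex;
  out_gate : vertex;
  circuit_acyclic : forall v w : vertex, feeds (gate_of v) w ->
    ~~ connect (fun a b => feeds (gate_of a) b) w v
}.

Definition const_bits (V : Type) (g : gate V) : nat :=
  if g is Const c then rat_bits c else 0%N.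

Definition circuit_bits (C : circuit) : nat :=
  (#|vertex C| + \sum_(v : vertex C) const_bits (gate_of v))%N.

Record arm_instance : Type := ArmInstance {
  arm_rows : nat;
  arm_cols : nat;
  arm_constraints : seq ('M[rat]_(arm_rows, arm_cols) * rat)
}.

Definition arm3_feasible (R : realType) (P : arm_instance) : Prop :=
  exists2 X : 'M[R]_(arm_rows P, arm_cols P),
    (\rank X <= 3)%N &
    forall Ab, Ab \in arm_constraints P ->
      \sum_i \sum_j ratr (Ab.1 i j) * X i j = ratr Ab.2.

Definition arm_bits (P : arm_instance) : nat :=
  (\sum_(Ab <- arm_constraints P)
     (\sum_i \sum_j rat_bits (Ab.1 i j) + rat_bits Ab.2))%N.

(* The slots of [v] that are occurrences of a circuit value: the output of [v]
   and each use of a value as an operand of [v]. *)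
Definition occurs (C : circuit) (v : vertex C) (s : slot) : bool :=
  if s is Out then true else operand (gate_of v) s != None.

(* The choices left open by the construction: the gauge index sets, the fresh
   rows and columns of the gadget of each gate (at most [K] of each), and the
   carrier positions.  [carrier v s] is meaningful only when [occurs v s]. *)
Record layout (K : nat) (C : circuit) : Type := Layout {
  nrows : nat;
  ncols : nat;
  I0 : {set 'I_nrows};
  J0 : {set 'I_ncols};
  card_I0 : #|I0| = 3%N;
  card_J0 : #|J0| = 3%N;
  gadget_rows : vertex C -> {set 'I_nrows};
  gadget_cols : vertex C -> {set 'I_ncols};
  gadget_rows_fresh : forall v, [disjoint gadget_rows v & I0];
  gadget_cols_fresh : forall v, [disjoint gadget_cols v & J0];
  gadget_rows_disjoint : forall v w, v != w ->
    [disjoint gadget_rows v & gadget_rows w];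
  gadget_cols_disjoint : forall v w, v != w ->
    [disjoint gadget_cols v & gadget_cols w];
  gadget_rows_bounded : forall v, (#|gadget_rows v| <= K)%N;
  gadget_cols_bounded : forall v, (#|gadget_cols v| <= K)%N;
  all_rows_used : I0 :|: \bigcup_v gadget_rows v = [set: 'I_nrows];
  all_cols_used : J0 :|: \bigcup_v gadget_cols v = [set: 'I_ncols];
  carrier : vertex C -> slot -> 'I_nrows * 'I_ncols;
  carrier_in_gadget : forall v s, occurs v s ->
    carrier v s \in setX (gadget_rows v) (gadget_cols v);
  carrier_inj : forall v s w t, occurs v s -> occurs w t ->
    carrier v s = carrier w t -> v = w /\ s = t;
  (* The carriers of z = x * y sit in a 2x2 block (1 x; y z): here
     [r1 = (carrier v Lhs).1] and [c1 = (carrier v Rhs).2]. *)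
  carrier_mul : forall v x y, gate_of v = Mul x y ->
    [/\ (carrier v Lhs).2 = (carrier v Out).2,
        (carrier v Rhs).1 = (carrier v Out).1,
        (carrier v Lhs).1 <> (carrier v Rhs).1 &
        (carrier v Rhs).2 <> (carrier v Lhs).2]
}.

Section Compile.
Variables (B : 'M[rat]_3) (K : nat) (C : circuit) (L : layout K C).

Let affine : Type := ('M[rat]_(nrows L, ncols L) * rat)%type.

Definition entry (p : 'I_(nrows L) * 'I_(ncols L)) :
  'M[rat]_(nrows L, ncols L) := delta_mx p.1 p.2.

(* [enum_val] lists a set of ordinals in increasing order. *)
Definition gauge_row (a : 'I_3) : 'I_(nrows L) :=
  enum_val (cast_ord (esym (card_I0 L)) a).
Definition gauge_col (b : 'I_3) : 'I_(ncols L) :=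
  enum_val (cast_ord (esym (card_J0 L)) b).

Definition gauge_constraints : seq affine :=
  [seq (entry (gauge_row a, gauge_col b), B a b)
     | a <- enum 'I_3, b <- enum 'I_3].

Definition copy (p q : 'I_(nrows L) * 'I_(ncols L)) : affine :=
  (entry p - entry q, 0).

Definition is_input (V : Type) (i : nat) (g : gate V) : bool :=
  if g is Input j then i == j else false.

(* Two input gates labelled by the same variable are occurrences of the same
   value; they are linked to one representative among them.  When input gates
   carry distinct variables, no constraint arises from them. *)
Definition copy_constraints (v : vertex C) : seq affine :=
  match gate_of v with
  | Input i =>
      if [pick w : vertex C | is_input i (gate_of w)] is Some w then
        if w == v then [::] else [:: copy (carrier L v Out) (carrier L w Out)]
      else [::]
  | Const _ => [::]
  | Add x y | Mul x y =>
      [:: copy (carrier L v Lhs) (carrier L x Out);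
          copy (carrier L v Rhs) (carrier L y Out)]
  | Neg x => [:: copy (carrier L v Lhs) (carrier L x Out)]
  end.

Definition gadget_constraints (v : vertex C) : seq affine :=
  let z := entry (carrier L v Out) in
  let x := entry (carrier L v Lhs) in
  let y := entry (carrier L v Rhs) in
  match gate_of v with
  | Input _ => [::]
  | Const c => [:: (z, c)]
  | Add _ _ => [:: (z - x - y, 0)]
  | Mul _ _ => [:: (entry ((carrier L v Lhs).1, (carrier L v Rhs).2), 1)]
  | Neg _ => [:: (z + x, 0)]
  end.

Definition output_constraint : affine := (entry (carrier L (out_gate C) Out), 0).

Definition compile : arm_instance :=
  ArmInstance
    (gauge_constraints
     ++ flatten [seq copy_constraints v | v <- enum (vertex C)]
     ++ flatten [seq gadget_constraints v | v <- enum (vertex C)]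
     ++ [:: output_constraint]).

End Compile.

Section StandardLayout.
Variable C : circuit.

Let index : finType := ('I_3 + vertex C * bool)%type.

Definition std_gauge : {set 'I_#|index|} :=
  [set enum_rank (inl a : index) | a : 'I_3].
Definition std_gadget (v : vertex C) : {set 'I_#|index|} :=
  [set enum_rank (inr (v, b) : index) | b : bool].

Definition std_carrier (v : vertex C) (s : slot) : 'I_#|index| * 'I_#|index| :=
  let e b := enum_rank (inr (v, b) : index) in
  match s with
  | Lhs => (e false, e true)
  | Rhs => (e true, e false)
  | Out => (e true, e true)
  end.

Lemma std_card_gauge : #|std_gauge| = 3%N.
Proof. by rewrite card_imset ?card_ord // => a b /enum_rank_inj []. Qed.

Lemma std_fresh v : [disjoint std_gadget v & std_gauge].
Proof.
by apply/pred0P=> k /=; apply/negP=> /andP[/imsetP[b _ ->] /imsetP[a _]] /enum_rank_inj.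
Qed.

Lemma std_disjoint v w : v != w -> [disjoint std_gadget v & std_gadget w].
Proof.
move/eqP=> vw; apply/pred0P=> k /=; apply/negP=> /andP[/imsetP[b _ ->]].
by move=> /imsetP[a _] /enum_rank_inj [].
Qed.

Lemma std_bounded v : (#|std_gadget v| <= 2)%N.
Proof. by rewrite -card_bool; exact: leq_imset_card. Qed.

Lemma std_used : std_gauge :|: \bigcup_v std_gadget v = [set: 'I_#|index|].
Proof.
apply/setP=> k; rewrite !inE -[k]enum_valK.
case: (enum_val k : index) => [a|[v b]]; first by apply/orP; left; exact: imset_f.
by apply/orP; right; apply/bigcupP; exists v => //; exact: imset_f.
Qed.

Lemma std_in_gadget v s : occurs v s ->
  std_carrier v s \in setX (std_gadget v) (std_gadget v).
Proof. by move=> _; case: s; rewrite inE; apply/andP; split; exact: imset_f. Qed.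

Lemma std_inj v s w t : occurs v s -> occurs w t ->
  std_carrier v s = std_carrier w t -> v = w /\ s = t.
Proof.
by move=> _ _; case: s; case: t => -[] /enum_rank_inj [] // ?;
   move=> /enum_rank_inj [].
Qed.

Lemma std_mul v x y : gate_of v = Mul x y ->
  [/\ (std_carrier v Lhs).2 = (std_carrier v Out).2,
      (std_carrier v Rhs).1 = (std_carrier v Out).1,
      (std_carrier v Lhs).1 <> (std_carrier v Rhs).1 &
      (std_carrier v Rhs).2 <> (std_carrier v Lhs).2].
Proof. by move=> _; split=> //= /enum_rank_inj. Qed.

Definition std_layout : layout 2 C :=
  Layout std_card_gauge std_card_gauge std_fresh std_fresh
    std_disjoint std_disjoint std_bounded std_bounded std_used std_used
    std_in_gadget std_inj std_mul.

End StandardLayout.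

(* Main.v *)
Require Import Defs.
From mathcomp Require Import all_boot all_order all_algebra.
From mathcomp Require Import zify.

(** Every gadget owns at most [K] rows and columns, so the matrices have side at
    most [3 + K s], where [s] is the bit-length of the circuit; their entries are
    sums of at most three signs, hence of constant bit-length, and there are at
    most [10 + 3 s] constraints.  The right-hand sides are 0, 1, an entry of the
    fixed matrix [B], or a constant of the circuit, each constant occurring once. *)

Set Implicit Arguments.
Unset Strict Implicit.
Unset Printing Implicit Defensive.

Local Open Scope ring_scope.

(** This is the summand of [arm_bits], so [arm_bits] unfolds to a plain sum of it over the
    constraint list. *)
Definition constraint_bits m n (Ab : 'M[rat]_(m, n) * rat) : nat :=
  (\sum_i \sum_j rat_bits (Ab.1 i j) + rat_bits Ab.2)%N.

Lemma leq_constraint_bits m n k d (A : 'M[rat]_(m, n)) (b : rat) :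
  (forall i j, (rat_bits (A i j) <= k)%N) -> (m <= d)%N -> (n <= d)%N ->
  (constraint_bits (A, b) <= k * d ^ 2 + rat_bits b)%N.
Proof.
move=> Ak md nd; rewrite leq_add2r.
apply: (@leq_trans (\sum_(i < m) \sum_(j < n) k)).
  by apply: leq_sum => i _; apply: leq_sum => j _; apply: Ak.
by rewrite !sum_nat_const !card_ord mulnA mulnC leq_mul2l leq_mul ?orbT.
Qed.

Lemma leq_card_bigcup (I T : finType) (F : I -> {set T}) k :
  (forall i, (#|F i| <= k)%N) -> (#|\bigcup_i F i| <= k * #|I|)%N.
Proof.
move=> Fk; apply: (@leq_trans (\sum_(i : I) #|F i|)).
  elim/big_rec2: _ => [|i n A _ An]; first by rewrite cards0.
  by rewrite (leq_trans (leq_card_setU _ _)) // leq_add2l.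
by rewrite mulnC -sum_nat_const leq_sum.
Qed.

Section Bounds.
Variables (B : 'M[rat]_3) (K : nat) (C : circuit) (L : layout K C).

Let d := (3 + K * circuit_bits C)%N.
(** Every coefficient is an integer of absolute value at most 3, and 5 is the value of [rat_bits] at
    2 and 3. *)
Let D := (5 * d ^ 2)%N.

(** Serves rows and columns alike: the gauge set and the gadgets cover all indices, and each gate
    adds at least 1 to [circuit_bits C]. *)
Lemma leq_card_layout m (I : {set 'I_m}) (F : vertex C -> {set 'I_m}) :
  #|I| = 3%N -> (forall v, (#|F v| <= K)%N) ->
  I :|: \bigcup_v F v = [set: 'I_m] -> (m <= d)%N.
Proof.
move=> I3 FK cover; rewrite -[leqLHS]card_ord -cardsT -cover.
rewrite (leq_trans (leq_card_setU _ _)) // I3 leq_add2l.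
by apply: leq_trans (leq_card_bigcup FK) _; rewrite leq_mul2l leq_addr orbT.
Qed.

Let position := ('I_(nrows L) * 'I_(ncols L))%type.

Let bound (A : 'M[rat]_(nrows L, ncols L)) b :
  (forall i j, (rat_bits (A i j) <= 5)%N) ->
  (constraint_bits (A, b) <= D + rat_bits b)%N.
Proof.
move=> A5; apply: leq_constraint_bits => //.
  exact: leq_card_layout (card_I0 L) (@gadget_rows_bounded _ _ L) (all_rows_used L).
exact: leq_card_layout (card_J0 L) (@gadget_cols_bounded _ _ L) (all_cols_used L).
Qed.

(* 4 is the common value of [rat_bits 0] and [rat_bits 1]. *)
Let bound0 (A : 'M[rat]_(nrows L, ncols L)) :
  (forall i j, (rat_bits (A i j) <= 5)%N) ->
  (constraint_bits (A, 0%R) <= D + 4)%N.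
Proof. exact: bound. Qed.

Let entry_bits (p : position) b :
  (constraint_bits (entry p, b) <= D + rat_bits b)%N.
(* Deciding whether [(i, j)] is the position [p] leaves a closed rational, whose bit-length is
   computed. *)
Proof. by apply: bound => i j; rewrite !mxE; case: (_ && _). Qed.

Lemma gauge_constraints_bits :
  (\sum_(Ab <- gauge_constraints B L) constraint_bits Ab
     <= 9 * D + \sum_a \sum_b rat_bits (B a b))%N.
Proof.
rewrite big_allpairs_dep big_enum /=.
apply: (@leq_trans (\sum_(a < 3) \sum_(b < 3) (D + rat_bits (B a b)))).
  by apply: leq_sum => a _; rewrite big_enum; apply: leq_sum => b _; apply: entry_bits.
by rewrite (eq_bigr _ (fun a _ => big_split _ _ _ _ _)) big_split /= !sum_nat_const
           !card_ord mulnA.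
Qed.

(** A gate is linked to at most two producers, one per operand; an input gate has at most one link,
    to its representative. *)
Lemma copy_constraints_bits v :
  (\sum_(Ab <- copy_constraints L v) constraint_bits Ab <= 2 * (D + 4))%N.
Proof.
have copy_bits (p q : position) : (constraint_bits (copy p q) <= D + 4)%N.
  by rewrite /copy; apply: bound0 => i j; rewrite !mxE; do 2 case: (_ && _).
have two (p q r t : position) :
    (\sum_(Ab <- [:: copy p q; copy r t]) constraint_bits Ab <= 2 * (D + 4))%N.
  by rewrite !big_cons big_nil addn0 mulSn mul1n leq_add.
have one (p q : position) :
    (\sum_(Ab <- [:: copy p q]) constraint_bits Ab <= 2 * (D + 4))%N.
  by rewrite big_seq1 (leq_trans (copy_bits _ _)) // leq_pmull.
rewrite /copy_constraints; case: (gate_of v) => [i|c|x y|x y|x] //.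
  by case: pickP => [w _|_]; [case: ifP|]; rewrite ?big_nil.
by rewrite big_nil.
Qed.

(** Each gate yields at most one equation. The 4 pays for a right-hand side 0 or 1, and [const_bits]
    for that of a constant gate. *)
Lemma gadget_constraints_bits v :
  (\sum_(Ab <- gadget_constraints L v) constraint_bits Ab
     <= D + 4 + const_bits (gate_of v))%N.
Proof.
rewrite /gadget_constraints; case: (gate_of v) => [i|c|x y|x y|x];
  rewrite ?big_nil ?big_seq1 //= ?addn0.
- by apply: leq_trans (entry_bits _ _) _; rewrite leq_add2r leq_addr.
- by apply: bound0 => i j; rewrite !mxE; do 3 case: (_ && _).
- exact: entry_bits.
- by apply: bound0 => i j; rewrite !mxE; do 2 case: (_ && _).
Qed.

(** The 10 counts nine gauge equations and the output; the 3 counts two copies and one gadget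
    equation per gate. *)
Lemma arm_bits_compile :
  (arm_bits (compile B L) <=
     \sum_a \sum_b rat_bits (B a b) +
     (10 + 3 * circuit_bits C) * (D + 4) + circuit_bits C)%N.
Proof.
have -> : (arm_bits (compile B L) =
    \sum_(Ab <- arm_constraints (compile B L)) constraint_bits Ab)%N by [].
have flat (F : vertex C -> seq ('M[rat]_(nrows L, ncols L) * rat)) :
    (\sum_(Ab <- flatten [seq F v | v <- enum (vertex C)]) constraint_bits Ab =
       \sum_v \sum_(Ab <- F v) constraint_bits Ab)%N.
  by rewrite big_flatten big_map big_enum.
rewrite !big_cat big_seq1 !flat.
have gauge := gauge_constraints_bits.
have out : (constraint_bits (output_constraint L) <= D + 4)%N := entry_bits _ 0.
have copies : (\sum_v \sum_(Ab <- copy_constraints L v) constraint_bits Ab <=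
    #|vertex C| * (2 * (D + 4)))%N.
  by rewrite -sum_nat_const; apply: leq_sum => v _; exact: copy_constraints_bits.
have gadgets : (\sum_v \sum_(Ab <- gadget_constraints L v) constraint_bits Ab <=
    #|vertex C| * (D + 4) + \sum_(v : vertex C) const_bits (gate_of v))%N.
  rewrite -sum_nat_const -big_split; apply: leq_sum => v _.
  exact: gadget_constraints_bits.
(* The only nonlinear inequality: once [D] is opaque, [lia] treats the products as atoms. *)
have V_le : (#|vertex C| * (D + 4) <= circuit_bits C * (D + 4))%N.
  by rewrite leq_mul2r leq_addr orbT.
have const_le : (\sum_(v : vertex C) const_bits (gate_of v) <= circuit_bits C)%N.
  exact: leq_addl.
apply: leq_trans (leq_add gauge (leq_add copies (leq_add gadgets out))) _.
clear -V_le const_le; clearbody D; lia.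
Qed.

End Bounds.

Theorem lemma7p2 (B : 'M[rat]_3) (hB : \det B != 0) (K : nat) :
  exists p : {poly nat},
    forall (C : circuit) (L : layout K C),
      (arm_bits (compile B L) <= (p.[circuit_bits C])%R)%N.
Proof.
pose b := (\sum_i \sum_j rat_bits (B i j))%N.
(* The bound of [arm_bits_compile] with ['X] for [circuit_bits C]: of degree at most 3, with
   coefficients depending only on [B] and [K]. *)
exists (b%:P + (10%N%:P + 3%N%:P * 'X) *
  (5%N%:P * (3%N%:P + K%:P * 'X) ^+ 2 + 4%N%:P) + 'X).
move=> C L; rewrite !(hornerD, hornerM, horner_exp, hornerC, hornerX).
exact: arm_bits_compile.
Qed.
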